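(* Let $\mathbb{K}$ be a field. For any group $G$ we have $cd^{par}_{\mathbb{K}}(G)\ge cd_{\mathbb{K}}(G)$. In particular, if $\mathrm{char}(\mathbb{K})=p>0$ and $G$ has $p$-torsion, then $cd^{par}_{\mathbb{K}}(G)=cd_{\mathbb{K}}(G)=\infty$.
   Context: $\mathbb{K}_{par}G$ is the unital associative $\mathbb{K}$-algebra generated by symbols $[g]$, $g\in G$, subject to $[g][h][h^{-1}]=[gh][h^{-1}]$, $[g^{-1}][g][h]=[g^{-1}][gh]$ and $[1]=1$ for all $g,h\in G$. The elements $e_g=[g][g^{-1}]$ are pairwise commuting idempotents, and $B$ denotes the commutative subalgebra of $\mathbb{K}_{par}G$ generated by $\{e_g\mid g\in G\}$. $B$ is a left $\mathbb{K}_{par}G$-module via $[g]\cdot b=[g]b[g^{-1}]$. The partial cohomological dimension $cd^{par}_{\mathbb{K}}(G)$ is the projective dimension of $B$ as a left $\mathbb{K}_{par}G$-module, i.e. $\max\{i\mid \mathrm{Ext}^i_{\mathbb{K}_{par}G}(B,V)\neq0\text{ for some left }\mathbb{K}_{par}G\text{-module }V\}$ (possibly $\infty$). The cohomological dimension $cd_{\mathbb{K}}(G)$ is the projective dimension of the trivial left $\mathbb{K}G$-module $\mathbb{K}$. *)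

(* Defs.v *)
From HB Require Import structures.
From mathcomp Require Import all_boot all_order all_algebra.
From mathcomp Require Import finmap generic_quotient.
From mathcomp Require Import monalg.
From mathcomp Require Import boolp constructive_ereal.

Set Implicit Arguments.
Unset Strict Implicit.
Unset Printing Implicit Defensive.

Import GRing.Theory Num.Theory.
Local Open Scope ring_scope.
Local Open Scope quotient_scope.

Definition projective (R : pzRingType) (P : lmodType R) : Prop :=
  forall (M N : lmodType R) (p : {linear M -> N}) (f : {linear P -> N}),
    (forall y, exists x, p x = y) ->
    exists g : {linear P -> M}, forall x, p (g x) = f x.

(* ... -> pr_mod 2 -> pr_mod 1 -> pr_mod 0 -> M -> 0, with pr_d i the map   *)
(* from degree i.+1 to degree i and pr_aug the augmentation.                *)
Record proj_resolution (R : pzRingType) (M : lmodType R) := ProjResolution {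
  pr_mod : nat -> lmodType R;
  pr_d : forall i, {linear pr_mod i.+1 -> pr_mod i};
  pr_aug : {linear pr_mod 0 -> M};
  pr_projective : forall i, projective (pr_mod i);
  pr_aug_surj : forall m, exists x, pr_aug x = m;
  pr_exact0 : forall x, pr_aug x = 0 <-> exists y, pr_d 0 y = x;
  pr_exactS : forall i x, pr_d i x = 0 <-> exists y, pr_d i.+1 y = x
}.

Section Ext.
Variables (R : pzRingType) (M V : lmodType R) (P : proj_resolution M).

Definition ext_cocycle (i : nat) (f : {linear pr_mod P i -> V}) : Prop :=
  forall y, f (pr_d P i y) = 0.

Definition ext_coboundary (i : nat) : {linear pr_mod P i -> V} -> Prop :=
  match i with
  | 0 => fun f => forall x, f x = 0
  | j.+1 => fun f =>
      exists g : {linear pr_mod P j -> V}, forall x, f x = g (pr_d P j x)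
  end.
End Ext.

(* Ext^i_R(M, V) <> 0: the complex Hom_R(P, V) has nonzero cohomology in    *)
(* degree i, for a projective resolution P of M. By the comparison theorem  *)
(* the choice of P is irrelevant.                                           *)
Definition Ext_neq0 (R : pzRingType) (i : nat) (M V : lmodType R) : Prop :=
  exists (P : proj_resolution M) (f : {linear pr_mod P i -> V}),
    ext_cocycle f /\ ~ ext_coboundary f.

(* The maximum of a set of natural numbers: +oo if it is unbounded, and by  *)
(* convention -oo if it is empty.                                           *)
Definition maxe (S : pred nat) : \bar int :=
  match pselect (exists n, S n),
        pselect (exists m, forall n, S n -> (n <= m)%N) with
  | left S0, left Sub => (Posz (ex_maxn S0 (projT2 (cid Sub))))%:E%E
  | left _, right _ => +oo%E
  | right _, _ => -oo%E
  end.

(* The largest i with Ext^i_R(M, V) <> 0 for some V; M <> 0 is implicit.    *)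
Definition projdim (R : pzRingType) (M : lmodType R) : \bar int :=
  maxe (fun i => `[< exists V : lmodType R, Ext_neq0 i M V >]).

(* The group algebra: finitely supported functions G -> K with convolution. *)

Definition grpalg (K : fieldType) (G : groupType) : Type := {malg K[G]}.

Section GroupAlgebra.
Variables (K : fieldType) (G : groupType).
Local Notation KG := (grpalg K G).

HB.instance Definition _ := GRing.Lmodule.copy KG {malg K[G]}.

Definition ga_one : KG := << 1 *g (1%g : G) >>.
Definition ga_mul (a b : KG) : KG :=
  \sum_(g <- msupp a) \sum_(h <- msupp b) << a@_g * b@_h *g (g * h)%g >>.

Lemma ga_mulw (d1 d2 : {fset G}) (a b : KG) :
  (msupp a `<=` d1)%fset -> (msupp b `<=` d2)%fset ->
  ga_mul a b =
    \sum_(g <- d1) \sum_(h <- d2) << a@_g * b@_h *g (g * h)%g >>.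
Proof.
move=> le1 le2; rewrite /ga_mul (big_fset_incl _ le1) /=.
  apply/eq_bigr=> g _; apply/big_fset_incl => // k _ /mcoeff_outdom ->.
  by rewrite mulr0 monalgU0.
move=> k _ /mcoeff_outdom ak.
by rewrite big1 => // k' _; rewrite ak mul0r monalgU0.
Qed.

Lemma ga_mul0l : left_zero (0 : KG) ga_mul.
Proof. by move=> b; rewrite /ga_mul msupp0 big_seq_fset0. Qed.

Lemma ga_mul0r : right_zero (0 : KG) ga_mul.
Proof.
by move=> b; rewrite /ga_mul big1 // => g _; rewrite msupp0 big_seq_fset0.
Qed.

Lemma ga_mulUU c1 c2 (g h : G) :
  ga_mul << c1 *g g >> << c2 *g h >> = << c1 * c2 *g (g * h)%g >>.
Proof. by rewrite (ga_mulw msuppU_le msuppU_le) !big_seq_fset1 !mcoeffUU. Qed.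

Lemma ga_mulDl : left_distributive ga_mul +%R.
Proof.
move=> a1 a2 b.
rewrite (ga_mulw (msuppD_le _ _) (fsubset_refl _)).
rewrite (ga_mulw (fsubsetUl _ (msupp a2)) (fsubset_refl (msupp b))).
rewrite (ga_mulw (fsubsetUr (msupp a1) _) (fsubset_refl (msupp b))).
rewrite -big_split /=; apply/eq_bigr=> g _.
rewrite -big_split /=; apply/eq_bigr=> h _.
by rewrite mcoeffD mulrDl monalgUD.
Qed.

Lemma ga_mulDr : right_distributive ga_mul +%R.
Proof.
move=> b a1 a2.
rewrite (ga_mulw (fsubset_refl _) (msuppD_le _ _)).
rewrite (ga_mulw (fsubset_refl (msupp b)) (fsubsetUl _ (msupp a2))).
rewrite (ga_mulw (fsubset_refl (msupp b)) (fsubsetUr (msupp a1) _)).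
rewrite -big_split /=; apply/eq_bigr=> g _.
rewrite -big_split /=; apply/eq_bigr=> h _.
by rewrite mcoeffD mulrDr monalgUD.
Qed.

Lemma ga_ind (Q : KG -> Prop) :
  Q 0 -> (forall a b, Q a -> Q b -> Q (a + b)) ->
  (forall c g, Q << c *g g >>) -> forall a, Q a.
Proof.
by move=> Q0 QD QU a; rewrite [a]monalgE; apply: big_ind => // g _; apply: QU.
Qed.

Lemma ga_mulA : associative ga_mul.
Proof.
move=> a b c; elim/ga_ind: a => [|a1 a2 H1 H2|c1 g].
- by rewrite !ga_mul0l.
- by rewrite !ga_mulDl H1 H2.
elim/ga_ind: b => [|b1 b2 H1 H2|c2 h].
- by rewrite !(ga_mul0l, ga_mul0r).
- by rewrite ga_mulDl !ga_mulDr ga_mulDl H1 H2.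
elim/ga_ind: c => [|b1 b2 H1 H2|c3 k].
- by rewrite !ga_mul0r.
- by rewrite !ga_mulDr H1 H2.
by rewrite !ga_mulUU mulrA mulgA.
Qed.

Lemma ga_mul1l : left_id ga_one ga_mul.
Proof.
move=> a; elim/ga_ind: a => [|a1 a2 H1 H2|c g].
- by rewrite ga_mul0r.
- by rewrite ga_mulDr H1 H2.
by rewrite ga_mulUU mul1r mul1g.
Qed.

Lemma ga_mul1r : right_id ga_one ga_mul.
Proof.
move=> a; elim/ga_ind: a => [|a1 a2 H1 H2|c g].
- by rewrite ga_mul0l.
- by rewrite ga_mulDl H1 H2.
by rewrite ga_mulUU mulr1 mulg1.
Qed.

Lemma ga_one_neq0 : ga_one != 0.
Proof. by rewrite monalgU_eq0 oner_eq0. Qed.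

HB.instance Definition _ := GRing.Zmodule_isNzRing.Build KG
  ga_mulA ga_mul1l ga_mul1r ga_mulDl ga_mulDr ga_one_neq0.

Lemma ga_mulE (a b : KG) : a * b = ga_mul a b. Proof. by []. Qed.

Lemma ga_scaleUE c d (g : G) : c *: (<< d *g g >> : KG) = << c * d *g g >>.
Proof. by apply/malgP => k; rewrite mcoeffZ !mcoeffU mulrnAr. Qed.

Lemma ga_scaleAl (c : K) (a b : KG) : c *: (a * b) = (c *: a) * b.
Proof.
elim/ga_ind: a => [|a1 a2 H1 H2|d g].
- by rewrite scaler0 !mul0r scaler0.
- by rewrite mulrDl !scalerDr mulrDl H1 H2.
elim/ga_ind: b => [|a1 a2 H1 H2|d' h].
- by rewrite !mulr0 scaler0.
- by rewrite mulrDr scalerDr mulrDr H1 H2.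
by rewrite ga_scaleUE !ga_mulE !ga_mulUU ga_scaleUE mulrA.
Qed.

Lemma ga_scaleAr (c : K) (a b : KG) : c *: (a * b) = a * (c *: b).
Proof.
elim/ga_ind: a => [|a1 a2 H1 H2|d g].
- by rewrite !mul0r scaler0.
- by rewrite mulrDl scalerDr mulrDl H1 H2.
elim/ga_ind: b => [|a1 a2 H1 H2|d' h].
- by rewrite mulr0 scaler0 mulr0.
- by rewrite mulrDr !scalerDr mulrDr H1 H2.
by rewrite ga_scaleUE !ga_mulE !ga_mulUU ga_scaleUE mulrCA.
Qed.

HB.instance Definition _ := GRing.Lmodule_isLalgebra.Build K KG ga_scaleAl.
HB.instance Definition _ := GRing.Lalgebra_isAlgebra.Build K KG ga_scaleAr.

Definition ga_aug (a : KG) : K := \sum_(g <- msupp a) a@_g.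

Lemma ga_augw (d : {fset G}) (a : KG) :
  (msupp a `<=` d)%fset -> ga_aug a = \sum_(g <- d) a@_g.
Proof. by move=> le; apply: big_fset_incl => // g _ /mcoeff_outdom. Qed.

Lemma ga_augU c (g : G) : ga_aug << c *g g >> = c.
Proof. by rewrite (ga_augw msuppU_le) big_seq_fset1 mcoeffUU. Qed.

Lemma ga_aug0 : ga_aug 0 = 0.
Proof. by rewrite /ga_aug msupp0 big_seq_fset0. Qed.

Lemma ga_augD : {morph ga_aug : a b / a + b}.
Proof.
move=> a b; rewrite (ga_augw (msuppD_le a b)).
rewrite (ga_augw (fsubsetUl (msupp a) (msupp b))).
rewrite (ga_augw (fsubsetUr (msupp a) (msupp b))) -big_split /=.
by apply: eq_bigr => g _; rewrite mcoeffD.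
Qed.

Lemma ga_aug1 : ga_aug 1 = 1. Proof. exact: ga_augU. Qed.

Lemma ga_augM : {morph ga_aug : a b / a * b}.
Proof.
move=> a b; elim/ga_ind: a => [|a1 a2 H1 H2|d g].
- by rewrite mul0r ga_aug0 mul0r.
- by rewrite mulrDl !ga_augD mulrDl H1 H2.
elim/ga_ind: b => [|a1 a2 H1 H2|d' h].
- by rewrite mulr0 ga_aug0 mulr0.
- by rewrite mulrDr !ga_augD mulrDr H1 H2.
by rewrite ga_mulE ga_mulUU !ga_augU.
Qed.

End GroupAlgebra.

(* K with every g in G acting as the identity. *)
Definition trivmod (K : fieldType) (G : groupType) : Type := K.

Section TrivialModule.
Variables (K : fieldType) (G : groupType).
Local Notation KG := (grpalg K G).
Local Notation triv := (trivmod K G).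

HB.instance Definition _ := GRing.Zmodule.copy triv K.

Definition triv_scale (a : KG) (x : triv) : triv := ga_aug a * (x : K).

Fact triv_scaleA a b x : triv_scale a (triv_scale b x) = triv_scale (a * b) x.
Proof. by rewrite /triv_scale ga_augM mulrA. Qed.
Fact triv_scale1 : left_id 1 triv_scale.
Proof. by move=> x; rewrite /triv_scale ga_aug1 mul1r. Qed.
Fact triv_scaleDr : right_distributive triv_scale +%R.
Proof. by move=> a x y; apply: mulrDr. Qed.
Fact triv_scaleDl x : {morph triv_scale^~ x : a b / a + b}.
Proof. by move=> a b; rewrite /triv_scale ga_augD mulrDl. Qed.

HB.instance Definition _ := GRing.Zmodule_isLmodule.Build KG triv
  triv_scaleA triv_scale1 triv_scaleDr triv_scaleDl.

Lemma triv_scaleE (g : G) (x : triv) : (<< 1 *g g >> : KG) *: x = x.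
Proof. by rewrite /GRing.scale /= /triv_scale ga_augU mul1r. Qed.

End TrivialModule.

(* The partial group algebra, by generators and relations: expressions in   *)
(* the symbols [g] modulo the least congruence par_cong that contains the   *)
(* axioms of unital associative K-algebras and the three defining families  *)
(* of relations. PCst c stands for c times the unit.                        *)

Inductive par_term (K : fieldType) (G : groupType) : Type :=
  | PGen of G
  | PCst of K
  | PAdd of par_term K G & par_term K G
  | PMul of par_term K G & par_term K G.
Arguments PGen {K G}.
Arguments PCst {K G}.

Inductive par_cong (K : fieldType) (G : groupType) :
    par_term K G -> par_term K G -> Prop :=
  | pc_refl s : par_cong s s
  | pc_sym s t : par_cong s t -> par_cong t s
  | pc_trans s t u : par_cong s t -> par_cong t u -> par_cong s u
  | pc_add s s' t t' : par_cong s s' -> par_cong t t' ->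
      par_cong (PAdd s t) (PAdd s' t')
  | pc_mul s s' t t' : par_cong s s' -> par_cong t t' ->
      par_cong (PMul s t) (PMul s' t')
  | pc_addA s t u : par_cong (PAdd s (PAdd t u)) (PAdd (PAdd s t) u)
  | pc_addC s t : par_cong (PAdd s t) (PAdd t s)
  | pc_add0 t : par_cong (PAdd (PCst 0) t) t
  | pc_addN t : par_cong (PAdd (PMul (PCst (-1)) t) t) (PCst 0)
  | pc_mulA s t u : par_cong (PMul s (PMul t u)) (PMul (PMul s t) u)
  | pc_mul1l t : par_cong (PMul (PCst 1) t) t
  | pc_mul1r t : par_cong (PMul t (PCst 1)) t
  | pc_mulDl s t u :
      par_cong (PMul (PAdd s t) u) (PAdd (PMul s u) (PMul t u))
  | pc_mulDr s t u :
      par_cong (PMul s (PAdd t u)) (PAdd (PMul s t) (PMul s u))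
  | pc_cstD a b : par_cong (PCst (a + b)) (PAdd (PCst a) (PCst b))
  | pc_cstM a b : par_cong (PCst (a * b)) (PMul (PCst a) (PCst b))
  | pc_cstC a t : par_cong (PMul (PCst a) t) (PMul t (PCst a))
  | pc_relr (g h : G) :                     (* [g][h][h^-1] = [gh][h^-1] *)
      par_cong (PMul (PMul (PGen g) (PGen h)) (PGen h^-1%g))
               (PMul (PGen (g * h)%g) (PGen h^-1%g))
  | pc_rell (g h : G) :                     (* [g^-1][g][h] = [g^-1][gh] *)
      par_cong (PMul (PMul (PGen g^-1%g) (PGen g)) (PGen h))
               (PMul (PGen g^-1%g) (PGen (g * h)%g))
  | pc_one : par_cong (PGen 1%g) (PCst 1).                    (* [1] = 1 *)

HB.instance Definition _ K G := gen_eqMixin (par_term K G).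
HB.instance Definition _ K G := gen_choiceMixin (par_term K G).

Section ParAlgebra.
Variables (K : fieldType) (G : groupType).
Local Notation T := (par_term K G).

Definition par_congb (s t : T) : bool := `[< par_cong s t >].

Lemma par_congb_equiv : equiv_class_of par_congb.
Proof.
split=> [s|s t|t s u].
- exact/asboolP/pc_refl.
- by apply: asbool_equiv_eq; split; apply: pc_sym.
- by move=> /asboolP st /asboolP tu; apply/asboolP/(pc_trans st tu).
Qed.

Canonical par_congb_equivrel := EquivRelPack par_congb_equiv.

Definition paralg : Type := {eq_quot par_congb}.

HB.instance Definition _ := Choice.copy paralg {eq_quot par_congb}.

Definition par_pi (t : T) : paralg := \pi_({eq_quot par_congb}) t.
Definition par_repr (a : paralg) : T := repr (a : {eq_quot par_congb}).

Lemma par_reprK : cancel par_repr par_pi. Proof. exact: reprK. Qed.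

Lemma par_piP s t : par_pi s = par_pi t <-> par_cong s t.
Proof.
split=> [/eqP|st]; first by rewrite eqmodE => /asboolP.
by apply/eqP; rewrite eqmodE; apply/asboolP.
Qed.

Lemma par_repr_pi t : par_cong (par_repr (par_pi t)) t.
Proof. by apply/par_piP; rewrite par_reprK. Qed.

Lemma par_pi_ind (Q : paralg -> Prop) : (forall t, Q (par_pi t)) -> forall a, Q a.
Proof. by move=> H a; rewrite -(par_reprK a). Qed.

Definition par_zero : paralg := par_pi (PCst 0).
Definition par_unit : paralg := par_pi (PCst 1).
Definition par_add (a b : paralg) : paralg :=
  par_pi (PAdd (par_repr a) (par_repr b)).
Definition par_opp (a : paralg) : paralg :=
  par_pi (PMul (PCst (-1)) (par_repr a)).
Definition par_mul (a b : paralg) : paralg :=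
  par_pi (PMul (par_repr a) (par_repr b)).
Definition par_scale (c : K) (a : paralg) : paralg :=
  par_pi (PMul (PCst c) (par_repr a)).

Lemma par_add_pi s t : par_add (par_pi s) (par_pi t) = par_pi (PAdd s t).
Proof. by apply/par_piP/pc_add; apply: par_repr_pi. Qed.
Lemma par_mul_pi s t : par_mul (par_pi s) (par_pi t) = par_pi (PMul s t).
Proof. by apply/par_piP/pc_mul; apply: par_repr_pi. Qed.
Lemma par_opp_pi t : par_opp (par_pi t) = par_pi (PMul (PCst (-1)) t).
Proof. by apply/par_piP/pc_mul; [apply: pc_refl | apply: par_repr_pi]. Qed.
Lemma par_scale_pi c t : par_scale c (par_pi t) = par_pi (PMul (PCst c) t).
Proof. by apply/par_piP/pc_mul; [apply: pc_refl | apply: par_repr_pi]. Qed.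

Fact par_addA : associative par_add.
Proof.
elim/par_pi_ind=> s; elim/par_pi_ind=> t; elim/par_pi_ind=> u.
by rewrite !par_add_pi; apply/par_piP/pc_addA.
Qed.
Fact par_addC : commutative par_add.
Proof.
elim/par_pi_ind=> s; elim/par_pi_ind=> t.
by rewrite !par_add_pi; apply/par_piP/pc_addC.
Qed.
Fact par_add0 : left_id par_zero par_add.
Proof.
by elim/par_pi_ind=> s; rewrite par_add_pi; apply/par_piP/pc_add0.
Qed.
Fact par_addN : left_inverse par_zero par_opp par_add.
Proof.
elim/par_pi_ind=> s; rewrite par_opp_pi par_add_pi.
exact/par_piP/pc_addN.
Qed.

HB.instance Definition _ := GRing.isZmodule.Build paralg
  par_addA par_addC par_add0 par_addN.

Lemma par_piD s t : par_pi (PAdd s t) = par_pi s + par_pi t.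
Proof. by rewrite -par_add_pi. Qed.

Fact par_mulA : associative par_mul.
Proof.
elim/par_pi_ind=> s; elim/par_pi_ind=> t; elim/par_pi_ind=> u.
by rewrite !par_mul_pi; apply/par_piP/pc_mulA.
Qed.
Fact par_mul1l : left_id par_unit par_mul.
Proof.
by elim/par_pi_ind=> s; rewrite par_mul_pi; apply/par_piP/pc_mul1l.
Qed.
Fact par_mul1r : right_id par_unit par_mul.
Proof.
by elim/par_pi_ind=> s; rewrite par_mul_pi; apply/par_piP/pc_mul1r.
Qed.
Fact par_mulDl : left_distributive par_mul +%R.
Proof.
elim/par_pi_ind=> s; elim/par_pi_ind=> t; elim/par_pi_ind=> u.
rewrite -par_piD !par_mul_pi -par_piD.
exact/par_piP/pc_mulDl.
Qed.
Fact par_mulDr : right_distributive par_mul +%R.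
Proof.
elim/par_pi_ind=> s; elim/par_pi_ind=> t; elim/par_pi_ind=> u.
rewrite -par_piD !par_mul_pi -par_piD.
exact/par_piP/pc_mulDr.
Qed.

(* The values of expressions under [g] |-> 1, used to see that 1 <> 0. *)
Fixpoint par_term_aug (t : T) : K :=
  match t with
  | PGen _ => 1
  | PCst c => c
  | PAdd s u => par_term_aug s + par_term_aug u
  | PMul s u => par_term_aug s * par_term_aug u
  end.

Lemma par_term_aug_cong s t : par_cong s t -> par_term_aug s = par_term_aug t.
Proof.
elim=> //= {s t}.
- by move=> s t u _ -> _ ->.
- by move=> s s' t t' _ -> _ ->.
- by move=> s s' t t' _ -> _ ->.
- by move=> s t u; rewrite addrA.
- by move=> s t; rewrite addrC.
- by move=> t; rewrite add0r.
- by move=> t; rewrite mulN1r addNr.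
- by move=> s t u; rewrite mulrA.
- by move=> t; rewrite mul1r.
- by move=> t; rewrite mulr1.
- by move=> s t u; rewrite mulrDl.
- by move=> s t u; rewrite mulrDr.
- by move=> a t; rewrite mulrC.
- by move=> g h; rewrite !mulr1.
- by move=> g h; rewrite !mulr1.
Qed.

Fact par_unit_neq0 : par_unit != 0.
Proof.
apply/eqP => /par_piP/par_term_aug_cong /= /eqP.
by rewrite oner_eq0.
Qed.

HB.instance Definition _ := GRing.Zmodule_isNzRing.Build paralg
  par_mulA par_mul1l par_mul1r par_mulDl par_mulDr par_unit_neq0.

Lemma par_piM s t : par_pi (PMul s t) = par_pi s * par_pi t.
Proof. by rewrite -par_mul_pi. Qed.
Lemma par_pi0 : par_pi (PCst 0) = 0. Proof. by []. Qed.
Lemma par_pi1 : par_pi (PCst 1) = 1. Proof. by []. Qed.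

Lemma par_scaleE c a : par_scale c a = par_pi (PCst c) * a.
Proof. by elim/par_pi_ind: a => t; rewrite par_scale_pi par_piM. Qed.

Fact par_scaleA a b v : par_scale a (par_scale b v) = par_scale (a * b) v.
Proof.
rewrite !par_scaleE mulrA -par_piM; congr (_ * _).
exact/par_piP/pc_sym/pc_cstM.
Qed.
Fact par_scale1 : left_id 1 par_scale.
Proof. by move=> v; rewrite par_scaleE par_pi1 mul1r. Qed.
Fact par_scaleDr : right_distributive par_scale +%R.
Proof. by move=> c u v; rewrite !par_scaleE mulrDr. Qed.
Fact par_scaleDl v : {morph par_scale^~ v : a b / a + b}.
Proof.
move=> a b; rewrite !par_scaleE -mulrDl -par_piD; congr (_ * _).
exact/par_piP/pc_cstD.
Qed.

HB.instance Definition _ := GRing.Zmodule_isLmodule.Build K paralg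
  par_scaleA par_scale1 par_scaleDr par_scaleDl.

Fact par_scaleAl (c : K) (a b : paralg) : c *: (a * b) = (c *: a) * b.
Proof. by rewrite /GRing.scale /= !par_scaleE mulrA. Qed.
Fact par_scaleAr (c : K) (a b : paralg) : c *: (a * b) = a * (c *: b).
Proof.
rewrite /GRing.scale /= !par_scaleE !mulrA; congr (_ * _).
by elim/par_pi_ind: a => t; rewrite -!par_piM; apply/par_piP/pc_cstC.
Qed.

HB.instance Definition _ := GRing.Lmodule_isLalgebra.Build K paralg par_scaleAl.
HB.instance Definition _ := GRing.Lalgebra_isAlgebra.Build K paralg par_scaleAr.

Lemma par_piC c : par_pi (PCst c) = c%:A.
Proof. by rewrite /GRing.scale /= par_scaleE mulr1. Qed.

Definition par_gen (g : G) : paralg := par_pi (PGen g).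
Definition par_idem (g : G) : paralg := par_gen g * par_gen g^-1%g.

Local Notation "[[ g ]]" := (par_gen g%g) (at level 0, format "[[ g ]]").

Lemma par_relr g h : [[g]] * [[h]] * [[h^-1]] = [[g * h]] * [[h^-1]].
Proof. by rewrite /par_gen -!par_piM; apply/par_piP/pc_relr. Qed.
Lemma par_rell g h : [[g^-1]] * [[g]] * [[h]] = [[g^-1]] * [[g * h]].
Proof. by rewrite /par_gen -!par_piM; apply/par_piP/pc_rell. Qed.
Lemma par_gen1 : [[1]] = 1.
Proof. exact/par_piP/pc_one. Qed.

Lemma par_genVg g : [[g]] * [[g^-1]] * [[g]] = [[g]].
Proof. by have := par_relr g g^-1%g; rewrite invgK mulgV par_gen1 mul1r. Qed.

Lemma par_gen_idem g h : [[g]] * par_idem h = par_idem (g * h)%g * [[g]].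
Proof.
have := par_rell (g * h)%g h^-1%g; rewrite mulgK => E.
rewrite /par_idem mulrA par_relr -[RHS]mulrA -E.
by rewrite !mulrA par_genVg.
Qed.

Lemma par_idemC g h : par_idem g * par_idem h = par_idem h * par_idem g.
Proof.
rewrite {1}/par_idem -mulrA par_gen_idem mulrA par_gen_idem mulVKg.
by rewrite -mulrA.
Qed.

Lemma par_idem_idem g : par_idem g * par_idem g = par_idem g.
Proof. by rewrite /par_idem mulrA par_genVg. Qed.

(* B, the K-subalgebra generated by the par_idem g. *)
Definition in_parB : {pred paralg} := fun x =>
  `[< forall S : {pred paralg}, GRing.subalg_closed S ->
        (forall g, par_idem g \in S) -> x \in S >].

Lemma in_parB_subalg : GRing.subalg_closed in_parB.
Proof.
split.
- by apply/asboolP => S [S1 _ _] _.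
- move=> c x y /asboolP Bx /asboolP By; apply/asboolP => S SS Se.
  by case: (SS) => _ SL _; apply: SL; [apply: Bx | apply: By].
- move=> x y /asboolP Bx /asboolP By; apply/asboolP => S SS Se.
  by case: (SS) => _ _ SM; apply: SM; [apply: Bx | apply: By].
Qed.

Lemma in_parB_idem g : par_idem g \in in_parB.
Proof. by apply/asboolP => S _. Qed.

Lemma in_parB_ind (Q : paralg -> Prop) :
  Q 1 -> (forall c x y, Q x -> Q y -> Q (c *: x + y)) ->
  (forall x y, Q x -> Q y -> Q (x * y)) -> (forall g, Q (par_idem g)) ->
  forall x, x \in in_parB -> Q x.
Proof.
move=> Q1 QL QM Qe x /asboolP /(_ (fun y => `[< Q y >])) H.
apply/asboolP; apply: H => [|g]; last exact/asboolP.
split=> [|c y z|y z]; first exact/asboolP.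
- by move=> /asboolP Qy /asboolP Qz; apply/asboolP/QL.
- by move=> /asboolP Qy /asboolP Qz; apply/asboolP/QM.
Qed.

HB.instance Definition _ :=
  GRing.isSubalgClosed.Build K paralg in_parB in_parB_subalg.

Record parB : predArgType := ParB { parB_val : paralg;
                                   _ : parB_val \in in_parB }.

HB.instance Definition _ := [isSub for parB_val].
HB.instance Definition _ := [Choice of parB by <:].
HB.instance Definition _ := [SubChoice_isSubZmodule of parB by <:].

(* The action of the partial group algebra on B: an expression acts through *)
(* its generators, [g] acting by x |-> [g] x [g^-1].                        *)
Fixpoint par_term_act (t : T) (x : paralg) : paralg :=
  match t with
  | PGen g => par_gen g * x * par_gen g^-1%g
  | PCst c => c *: x
  | PAdd s u => par_term_act s x + par_term_act u x
  | PMul s u => par_term_act s (par_term_act u x)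
  end.

Lemma par_term_act_linear t : linear (par_term_act t).
Proof.
elim: t => [g|c|s IHs u IHu|s IHs u IHu] k x y /=.
- by rewrite mulrDr mulrDl -scalerAr -scalerAl.
- by rewrite scalerDr !scalerA mulrC.
- by rewrite IHs IHu scalerDr addrACA.
- by rewrite IHu IHs.
Qed.

Lemma par_term_actD t x y :
  par_term_act t (x + y) = par_term_act t x + par_term_act t y.
Proof. by have := par_term_act_linear t 1 x y; rewrite !scale1r. Qed.

Lemma par_term_act0 t : par_term_act t 0 = 0.
Proof. by apply: (addrI (par_term_act t 0)); rewrite -par_term_actD !addr0. Qed.

Lemma par_term_actZ t c x : par_term_act t (c *: x) = c *: par_term_act t x.
Proof.
by have := par_term_act_linear t c x 0; rewrite par_term_act0 !addr0.
Qed.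

Lemma par_term_act_cong s t :
  par_cong s t -> forall x, par_term_act s x = par_term_act t x.
Proof.
elim=> //= {s t}.
- by move=> s t u _ st _ tu x; rewrite st tu.
- by move=> s s' t t' _ Es _ Et x; rewrite Es Et.
- by move=> s s' t t' _ Es _ Et x; rewrite Es Et.
- by move=> s t u x; rewrite addrA.
- by move=> s t x; rewrite addrC.
- by move=> t x; rewrite scale0r add0r.
- by move=> t x; rewrite scaleN1r addNr scale0r.
- by move=> t x; rewrite scale1r.
- by move=> t x; rewrite scale1r.
- by move=> s t u x; rewrite par_term_actD.
- by move=> a b x; rewrite scalerDl.
- by move=> a b x; rewrite scalerA.
- by move=> a t x; rewrite par_term_actZ.
- move=> g h x; rewrite !mulrA par_relr -!mulrA; do 3 congr (_ * _).
  by rewrite !mulrA (par_rell h^-1%g g^-1%g) invgM.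
- move=> g h x; rewrite !mulrA par_rell -!mulrA; do 3 congr (_ * _).
  by rewrite !mulrA par_relr invgM.
- by move=> x; rewrite invg1 par_gen1 mul1r mulr1 scale1r.
Qed.

Lemma in_parB_comm_idem g x : x \in in_parB -> x * par_idem g = par_idem g * x.
Proof.
move: x; apply: in_parB_ind => [|c x y Ex Ey|x y Ex Ey|h].
- by rewrite mulr1 mul1r.
- by rewrite mulrDl mulrDr -scalerAl -scalerAr Ex Ey.
- by rewrite -mulrA Ey mulrA Ex mulrA.
- exact: par_idemC.
Qed.

Lemma in_parB_conj g x : x \in in_parB ->
  par_gen g * x * par_gen g^-1%g \in in_parB.
Proof.
move=> Bx; have: x \in in_parB /\ par_gen g * x * par_gen g^-1%g \in in_parB.
  move: x Bx; apply: in_parB_ind => [|c x y [Bx Bgx] [By Bgy]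
    |x y [Bx Bgx] [By Bgy]|h].
  - by rewrite mulr1 rpred1 in_parB_idem.
  - by rewrite mulrDr mulrDl -scalerAr -scalerAl !rpredD ?rpredZ.
  - split; first exact: rpredM.
    suff -> : par_gen g * (x * y) * par_gen g^-1%g =
      (par_gen g * x * par_gen g^-1%g) * (par_gen g * y * par_gen g^-1%g).
      exact: rpredM.
    have E : par_gen g * x = par_gen g * x * par_idem g^-1%g.
      by rewrite -mulrA in_parB_comm_idem // /par_idem invgK !mulrA par_genVg.
    by rewrite mulrA {1}E /par_idem invgK !mulrA.
  - split; first exact: in_parB_idem.
    by rewrite par_gen_idem -mulrA rpredM ?in_parB_idem.
by case.
Qed.

Lemma in_parB_act t x : x \in in_parB -> par_term_act t x \in in_parB.
Proof.
elim: t x => [g|c|s IHs u IHu|s IHs u IHu] x Bx /=.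
- exact: in_parB_conj.
- exact: rpredZ.
- by rewrite rpredD ?IHs ?IHu.
- by rewrite IHs ?IHu.
Qed.

Definition parB_scale (a : paralg) (x : parB) : parB :=
  ParB (in_parB_act (par_repr a) (valP x)).

Lemma parB_scale_pi t x :
  val (parB_scale (par_pi t) x) = par_term_act t (val x).
Proof. exact: par_term_act_cong (par_repr_pi t) _. Qed.

Fact parB_scaleA a b x : parB_scale a (parB_scale b x) = parB_scale (a * b) x.
Proof.
elim/par_pi_ind: a => s; elim/par_pi_ind: b => t; apply: val_inj.
by rewrite -par_piM !parB_scale_pi.
Qed.
Fact parB_scale1 : left_id 1 parB_scale.
Proof. by move=> x; apply: val_inj; rewrite parB_scale_pi /= scale1r. Qed.
Fact parB_scaleDr : right_distributive parB_scale +%R.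
Proof.
by elim/par_pi_ind=> t x y; apply: val_inj; rewrite /= par_term_actD.
Qed.
Fact parB_scaleDl x : {morph parB_scale^~ x : a b / a + b}.
Proof.
elim/par_pi_ind=> s; elim/par_pi_ind=> t; apply: val_inj.
rewrite -par_piD parB_scale_pi.
change (par_term_act s (val x) + par_term_act t (val x)
  = val (parB_scale (par_pi s) x) + val (parB_scale (par_pi t) x)).
by rewrite !parB_scale_pi.
Qed.

HB.instance Definition _ := GRing.Zmodule_isLmodule.Build paralg parB
  parB_scaleA parB_scale1 parB_scaleDr parB_scaleDl.

Lemma parB_scale_gen (g : G) (b : parB) :
  val (par_gen g *: b) = par_gen g * val b * par_gen g^-1%g.
Proof. exact: parB_scale_pi. Qed.

End ParAlgebra.

Definition cd (K : fieldType) (G : groupType) : \bar int :=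
  projdim (trivmod K G : lmodType (grpalg K G)).

Definition cd_par (K : fieldType) (G : groupType) : \bar int :=
  projdim (parB K G : lmodType (paralg K G)).

(* For p prime: G has an element of order p.                                *)
Definition has_torsion (p : nat) (G : groupType) : Prop :=
  exists g : G, g <> 1%g /\ (g ^+ p = 1)%g.

(* Main.v *)
Require Import Defs.
From HB Require Import structures.
From mathcomp Require Import all_boot all_order all_algebra.
From mathcomp Require Import finmap generic_quotient ring_quotient monalg.
From mathcomp Require Import boolp constructive_ereal.

Set Implicit Arguments.
Unset Strict Implicit.
Unset Printing Implicit Defensive.

Import GRing.Theory.
Local Open Scope ring_scope.
Local Open Scope quotient_scope.

(** The inequality comes from a change of rings along the surjection
    [par_to_ga] from the partial group algebra to the group algebra, [[g]]
    going to [g]. Its kernel is the ideal generated by the elements [1 - e_g],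
    where the [e_g = [g][g^-1]] ([par_idem]) are commuting idempotents. For a
    module [M] over the partial group algebra, the extension of scalars is
    therefore the quotient [unital M] of [M] by the elements killed by some
    finite product of the [e_g]. Such a quotient is a localisation, hence an
    exact functor ([unital_map_exact]); as a left adjoint of the exact
    restriction functor it preserves projectives ([unital_projective]); and it
    sends [B] to the trivial module, because in [B] the kernel of the
    augmentation consists exactly of the elements killed by some such product
    ([parB_aug_eq0]). So it turns a projective resolution [Q] of [B] into a
    projective resolution of the trivial module ([unital_resolution]), and by
    adjunction Hom(unital Q, V) = Hom(Q, res V) for every module [V] over the
    group algebra. Hence Ext^i(K, V) = Ext^i(B, res V), and a nonzero left-hand
    side forces a nonzero right-hand side ([Ext_neq0_par]). The comparison
    theorem ([Ext_neq0_resolution]) makes the choice of resolution irrelevant.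

    For the second part let [t] have order [p], and put
    [N = 1 + t + ... + t^(p-1)] in the group algebra [KG]. Call a module exact
    if its elements killed by [t - 1] are the multiples of [N] and its
    elements killed by [N] are the multiples of [t - 1]. [KG] is exact
    ([grpalg_exact_norm], [grpalg_exact_sub]), hence so are free modules and
    their direct summands, and a quotient of an exact module by an exact
    submodule is exact. If Ext^n(K, -) vanished for some [n > 0], the [n]-th
    syzygy of [K] in a free resolution would be a direct summand of a free
    module, so all syzygies down to [K] itself would be exact
    ([ann_exact_Ext]). But on [K] both [t - 1] and [N], which acts as
    multiplication by [p], are zero ([trivmod_not_exact]). So Ext^n(K, -) is
    nonzero for all [n > 0], the cohomological dimension is infinite, and by
    the inequality so is the partial one. *)

(** * Linear maps, kernels and lifting *)

Section LinearPack.
Variables (R : pzRingType) (U V : lmodType R) (f : U -> V) (fL : linear f).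

Let f_linear : GRing.isLinear.axioms_ R U V *:%R f :=
  GRing.isLinear.Build R U V *:%R f fL.
Definition linear_pack : {linear U -> V} := HB.pack f f_linear.

Lemma linear_packE x : linear_pack x = f x. Proof. by []. Qed.
End LinearPack.
Arguments linear_pack : simpl never.

Section Kernel.
Variables (R : pzRingType) (U V : lmodType R) (f : {linear U -> V}).

Definition in_ker : {pred U} := fun x => f x == 0.

Lemma in_ker_submod : submod_closed in_ker.
Proof.
split=> [|a x y /eqP fx /eqP fy]; first by rewrite -topredE /= /in_ker raddf0.
by rewrite -topredE /= /in_ker linearP fx fy scaler0 addr0.
Qed.

HB.instance Definition _ := GRing.isSubmodClosed.Build R U in_ker in_ker_submod.

Record kermod : predArgType := KerMod { ker_val : U; _ : ker_val \in in_ker }.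

HB.instance Definition _ := [isSub for ker_val].
HB.instance Definition _ := [Choice of kermod by <:].
HB.instance Definition _ := [SubChoice_isSubLmodule of kermod by <:].

Lemma kermodP (x : kermod) : f (val x) = 0.
Proof. by apply/eqP; exact: (valP x). Qed.

Lemma ker_lift x : f x = 0 -> exists y : kermod, val y = x.
Proof. by move=> /eqP fx; exists (KerMod (fx : x \in in_ker)). Qed.

Lemma val_kermod_linear : linear (val : kermod -> U).
Proof. exact: linearP. Qed.
End Kernel.

(** Projectivity only speaks of surjections onto the target; the version for
    maps that merely land in an image follows by lifting the identity through
    the pullback of [f] and [g]. *)
Lemma projective_lift (R : pzRingType) (P A B : lmodType R)
    (f : {linear P -> B}) (g : {linear A -> B}) :
  projective P -> (forall x, exists a, g a = f x) ->
  exists h : {linear P -> A}, forall x, g (h x) = f x.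
Proof.
move=> projP im_f.
pose k (u : P * A) : B := f u.1 - g u.2.
have kL : linear k.
  by move=> c u v; rewrite /k /= !linearP addrACA scalerBr -scalerN.
pose W := kermod (linear_pack kL).
have p_lin : linear (fun w : W => (val w).1) by [].
have q_lin : linear (fun w : W => (val w).2) by [].
have [|s sE] := projP _ _ (linear_pack p_lin) idfun.
  move=> x; have [a ga] := im_f x.
  have [|w wE] := @ker_lift _ _ _ (linear_pack kL) (x, a).
    by rewrite linear_packE /k /= ga subrr.
  by exists w; rewrite linear_packE wE.
have h_lin : linear (fun x => (val (s x)).2).
  by move=> c x y; rewrite linearP q_lin.
exists (linear_pack h_lin) => x; rewrite linear_packE.
have /eqP := kermodP (s x); rewrite linear_packE /k subr_eq0 => /eqP <-.
by have := sE x; rewrite linear_packE /= => ->.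
Qed.

(** * The comparison theorem *)

Section Comparison.
Variables (R : pzRingType) (M : lmodType R).

(** [lifts i u]: the map [u] is the degree-[i] component of a chain map that
    covers the identity of [M]; only the degrees up to [i] matter, so no
    infinite sequence of maps has to be chosen. *)
Fixpoint lifts (P Q : proj_resolution M) (i : nat) :
    {linear pr_mod P i -> pr_mod Q i} -> Prop :=
  match i with
  | 0 => fun u => forall x, pr_aug Q (u x) = pr_aug P x
  | j.+1 => fun u => exists v : {linear pr_mod P j -> pr_mod Q j},
      lifts v /\ forall x, pr_d Q j (u x) = v (pr_d P j x)
  end.

Lemma pr_aug_d (P : proj_resolution M) x : pr_aug P (pr_d P 0 x) = 0.
Proof. by apply/pr_exact0; exists x. Qed.

Lemma pr_dd (P : proj_resolution M) i x : pr_d P i (pr_d P i.+1 x) = 0.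
Proof. by apply/pr_exactS; exists x. Qed.

Lemma lifts_exist (P Q : proj_resolution M) i :
  exists u : {linear pr_mod P i -> pr_mod Q i}, lifts u.
Proof.
elim: i => [|i [v vL]].
  apply: projective_lift => [|x]; first exact: pr_projective.
  exact: pr_aug_surj.
have [||u uE] := @projective_lift _ (pr_mod P i.+1) (pr_mod Q i.+1)
    (pr_mod Q i) (v \o pr_d P i) (pr_d Q i).
- exact: pr_projective.
- move=> x; case: i v vL x => [|i] v /= vL x.
    by apply/pr_exact0; rewrite vL pr_aug_d.
  have [w [_ wE]] := vL.
  by apply/pr_exactS; rewrite wE pr_dd raddf0.
- by exists u, v.
Qed.

Lemma lifts_id (P : proj_resolution M) i : @lifts P P i idfun.
Proof. by elim: i => [//|i IH]; exists idfun. Qed.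

Lemma lifts_comp (P Q S : proj_resolution M) i
    (u : {linear pr_mod P i -> pr_mod Q i})
    (v : {linear pr_mod Q i -> pr_mod S i}) :
  lifts u -> lifts v -> @lifts P S i (v \o u).
Proof.
elim: i u v => [|i IH] u v /=; first by move=> uL vL x; rewrite vL uL.
move=> [u' [u'L u'E]] [v' [v'L v'E]]; exists (v' \o u').
by split=> [|x]; [exact: IH | rewrite /= v'E u'E].
Qed.

(** [homotopy u v h]: the component [h] raising degree [i] to [i.+1] belongs
    to a chain homotopy from [v] to [u]; the component [s] one degree below is
    kept existential, as it vanishes for [i = 0]. *)
Definition homotopy (P Q : proj_resolution M) (i : nat) :
    {linear pr_mod P i -> pr_mod Q i} -> {linear pr_mod P i -> pr_mod Q i} ->
    {linear pr_mod P i -> pr_mod Q i.+1} -> Prop :=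
  match i with
  | 0 => fun u v h => forall x, u x - v x = pr_d Q 0 (h x)
  | j.+1 => fun u v h => exists s : {linear pr_mod P j -> pr_mod Q j.+1},
      forall x, u x - v x = pr_d Q j.+1 (h x) + s (pr_d P j x)
  end.

(** By induction the homotopy [s] one degree below exists, and [u - v - s d]
    then takes values in the cycles, which are boundaries. *)
Lemma lifts_homotopic (P Q : proj_resolution M) i
    (u v : {linear pr_mod P i -> pr_mod Q i}) :
  lifts u -> lifts v -> exists h, homotopy u v h.
Proof.
elim: i u v => [|i IH] u v /=.
  move=> uL vL.
  have [||h hE] := @projective_lift _ _ _ _ (u \- v) (pr_d Q 0).
  - exact: pr_projective.
  - by move=> x; apply/pr_exact0; rewrite /= raddfB /= uL vL subrr.
  - by exists h => x; rewrite hE.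
move=> [u' [u'L u'E]] [v' [v'L v'E]].
have [s sE] := IH _ _ u'L v'L.
have [||h hE] := @projective_lift _ _ _ _ (u \- v \- (s \o pr_d P i))
    (pr_d Q i.+1).
- exact: pr_projective.
- move=> x; apply/pr_exactS; rewrite /= !raddfB /= u'E v'E.
  apply/eqP; rewrite subr_eq0; apply/eqP.
  case: i IH u v u' u'L u'E v' v'L v'E s sE x
    => [|i] /= _ _ _ u' _ _ v' _ _ s sE x.
    exact: sE.
  have [s' s'E] := sE.
  by rewrite s'E pr_dd raddf0 addr0.
- by exists h, s => x; rewrite hE /= subrK.
Qed.

(** Comparison theorem for Ext: along lifts [u : P -> Q] and [v : Q -> P] a
    cocycle [f] of [P] is sent to the cocycle [f v] of [Q], and [f v u - f] is
    a coboundary because [v u] is homotopic to the identity. *)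
Lemma Ext_neq0_resolution (V : lmodType R) i (Q : proj_resolution M) :
  Ext_neq0 i M V ->
  exists f : {linear pr_mod Q i -> V}, ext_cocycle f /\ ~ ext_coboundary f.
Proof.
move=> [P [f [f_coc f_ncob]]].
have [u uL] := lifts_exist P Q i.
have [v' v'L] := lifts_exist Q P i.+1.
have [v [vL vE]] := v'L.
exists (f \o v); split=> [y|].
  by rewrite /= -vE f_coc.
apply: contra_not f_ncob.
have [h hE] := lifts_homotopic (lifts_id P i) (lifts_comp uL vL).
case: i f f_coc u uL v' v'L v vL vE h hE
  => [|i] f f_coc u uL v' v'L v vL vE h hE /=.
  move=> fv0 x; have /= := hE x => /(congr1 f); rewrite raddfB /= f_coc fv0.
  by rewrite subr0.
have [s sE] := hE; have [u' [_ u'E]] := uL.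
move=> [g gE]; exists ((g \o u') \+ (f \o s)) => x /=.
have /= := sE x => /(congr1 f); rewrite raddfB raddfD /= f_coc add0r => <-.
by rewrite -u'E -gE /= addrC subrK.
Qed.
End Comparison.

(** * Free modules and free resolutions *)

Section Free.
Variables (R : nzRingType) (X : choiceType).

Lemma malg_ind (S : zmodType) (Q : {malg S[X]} -> Prop) :
  Q 0 -> (forall a b, Q a -> Q b -> Q (a + b)) ->
  (forall c x, Q << c *g x >>) -> forall a, Q a.
Proof.
by move=> Q0 QD QU a; rewrite [a]monalgE; apply: big_ind => // x _; apply: QU.
Qed.

Lemma malg_scaleU c d (x : X) :
  c *: (<< d *g x >> : {malg R[X]}) = << c * d *g x >>.
Proof. by apply/malgP => k; rewrite mcoeffZ !mcoeffU mulrnAr. Qed.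

Variables (V : lmodType R) (h : X -> V).

Definition free_ext_fun (a : {malg R[X]}) : V :=
  \sum_(x <- msupp a) a@_x *: h x.

Lemma free_ext_funw (d : {fset X}) (a : {malg R[X]}) :
  (msupp a `<=` d)%fset -> free_ext_fun a = \sum_(x <- d) a@_x *: h x.
Proof.
by move=> le; apply: big_fset_incl => // x _ /mcoeff_outdom ->; rewrite scale0r.
Qed.

Lemma free_ext_fun_linear : linear free_ext_fun.
Proof.
move=> c a b; pose d := (msupp a `|` msupp b)%fset.
have suppa : (msupp a `<=` d)%fset by exact: fsubsetUl.
have suppb : (msupp b `<=` d)%fset by exact: fsubsetUr.
rewrite (free_ext_funw suppa) (free_ext_funw suppb) (@free_ext_funw d).
  rewrite scaler_sumr -big_split; apply: eq_bigr => x _ /=.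
  by rewrite mcoeffD mcoeffZ scalerDl scalerA.
apply: fsubset_trans (msuppD_le _ _) _; rewrite fsubUset suppb andbT.
exact: fsubset_trans (msuppZ_le _ _) suppa.
Qed.

Definition free_ext : {linear {malg R[X]} -> V} :=
  linear_pack free_ext_fun_linear.

Lemma free_extU c x : free_ext << c *g x >> = c *: h x.
Proof.
rewrite linear_packE (free_ext_funw (msuppU_le (x := c))).
by rewrite big_seq_fset1 mcoeffUU.
Qed.
End Free.
Arguments free_ext : simpl never.

Lemma free_linear_eq (R : nzRingType) (X : choiceType) (V : lmodType R)
    (f g : {linear {malg R[X]} -> V}) :
  (forall x, f << 1 *g x >> = g << 1 *g x >>) -> f =1 g.
Proof.
move=> fg; elim/malg_ind => [|a b fa fb|c x]; first by rewrite !raddf0.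
  by rewrite !linearD; move: fa fb => -> ->.
by rewrite -[c]mulr1 -malg_scaleU !linearZ fg.
Qed.

Lemma free_projective (R : nzRingType) (X : choiceType) :
  projective ({malg R[X]} : lmodType R).
Proof.
move=> M N p f p_surj.
pose s x := projT1 (cid (p_surj (f << 1 *g x >>))).
exists (free_ext s) => a.
have := @free_linear_eq _ _ _ (p \o free_ext s) f; apply => x.
change (p (free_ext s << 1 *g x >>) = f << 1 *g x >>).
by rewrite free_extU scale1r /s; case: cid.
Qed.

(** The free resolution in which each term is free on the underlying set of
    the previous syzygy; it needs no choice of generators. *)
Section FreeResolution.
Variables (R : nzRingType) (M : lmodType R).

Definition free_cover (N : lmodType R) : {linear {malg R[N]} -> N} :=
  free_ext id.

Lemma free_cover_surj (N : lmodType R) y : exists x, free_cover N x = y.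
Proof. by exists << 1 *g y >>; rewrite free_extU scale1r. Qed.

Fixpoint syzygy (n : nat) : lmodType R :=
  if n is j.+1 then kermod (free_cover (syzygy j)) : lmodType R else M.

Definition free_mod n : lmodType R := {malg R[syzygy n]}.

Definition syzygy_incl n : {linear syzygy n.+1 -> free_mod n} :=
  linear_pack (@val_kermod_linear _ _ _ (free_cover (syzygy n))).

Definition free_d n : {linear free_mod n.+1 -> free_mod n} :=
  syzygy_incl n \o free_cover (syzygy n.+1).

Lemma free_exact n x :
  free_cover (syzygy n) x = 0 <-> exists y, free_d n y = x.
Proof.
split=> [/ker_lift[z <-]|[y <-]]; last exact: kermodP.
by have [y yE] := free_cover_surj z; exists y; apply: (congr1 val yE).
Qed.

Lemma free_exactS n x : free_d n x = 0 <-> exists y, free_d n.+1 y = x.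
Proof.
rewrite -free_exact; split=> [dx|x0]; last exact: (congr1 val x0).
by apply: val_inj; exact: dx.
Qed.

Definition free_resolution : proj_resolution M :=
  @ProjResolution R M free_mod free_d (free_cover M)
    (fun n => @free_projective _ _) (@free_cover_surj M)
    (@free_exact 0) free_exactS.
End FreeResolution.

(** * A 2-periodic obstruction to finite projective dimension *)

Section Periodic.
Variable R : nzRingType.

(** Exactness at one spot of the 2-periodic complex on [M] whose differentials
    are alternately [a] and [b]. *)
Definition ann_exact (a b : R) (M : lmodType R) : Prop :=
  forall x : M, a *: x = 0 -> exists y, x = b *: y.

Lemma ann_exact_free a b (X : choiceType) :
  (forall c : R, a * c = 0 -> exists d, c = b * d) ->
  ann_exact a b {malg R[X]}.
Proof.
move=> exR x ax0.
have coef k : exists d, x@_k = b * d.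
  by apply: exR; rewrite -mcoeffZ ax0 mcoeff0.
pose d k := projT1 (cid (coef k)).
exists (\sum_(k <- msupp x) << d k *g k >>).
rewrite scaler_sumr {1}[x]monalgE; apply: eq_bigr => k _.
by rewrite malg_scaleU /d; case: cid => /= e <-.
Qed.

Lemma ann_exact_retract a b (M N : lmodType R) (i : {linear N -> M})
    (r : {linear M -> N}) :
  cancel i r -> ann_exact a b M -> ann_exact a b N.
Proof.
move=> iK exM x ax0; have [|y yE] := exM (i x).
  by rewrite -linearZ ax0 raddf0.
by exists (r y); rewrite -linearZ -yE iK.
Qed.

(** The connecting map of the long exact sequence, by hand: for [x] above a
    class killed by [a], the element [a *: x] lies in the kernel and is killed
    by [b], so [x] may be corrected by a kernel element. *)
Lemma ann_exact_quotient a b (F C : lmodType R) (p : {linear F -> C}) :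
  b * a = 0 -> (forall c, exists x, p x = c) ->
  ann_exact a b F -> ann_exact b a (kermod p) -> ann_exact a b C.
Proof.
move=> ba0 p_surj exF exK c ac0; have [x xE] := p_surj c.
have [|z zE] := @ker_lift _ _ _ p (a *: x); first by rewrite linearZ xE.
have [|y yE] := exK z.
  by apply: val_inj; rewrite linearZ /= zE scalerA ba0 scale0r.
have [|w wE] := exF (x - val y).
  by rewrite scalerBr -zE yE subrr.
by exists (p w); rewrite -linearZ -wE linearB kermodP subr0 xE.
Qed.

(** If Ext vanishes in degree [n.+1], the surjection of a free module onto the
    syzygy [n.+1], a cocycle, extends to the free module containing that
    syzygy. The syzygy is then a direct summand of a free module, hence exact,
    and exactness descends along the resolution down to [M]. *)
Lemma ann_exact_Ext a b (M : lmodType R) n :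
  a * b = 0 -> b * a = 0 ->
  (forall c, a * c = 0 -> exists d, c = b * d) ->
  (forall c, b * c = 0 -> exists d, c = a * d) ->
  (forall V : lmodType R, ~ Ext_neq0 n.+1 M V) ->
  ann_exact a b M.
Proof.
move=> ab0 ba0 exab exba noExt.
suff down i : (i <= n.+1)%N -> ann_exact a b (syzygy M (n.+1 - i)) /\
    ann_exact b a (syzygy M (n.+1 - i)).
  by have := down n.+1 (leqnn _); rewrite subnn => -[].
elim: i => [_|i IH lt_i_n].
  have /contrapT cob : ~ ~ @ext_coboundary _ M (syzygy M n.+1)
      (free_resolution M) n.+1 (free_cover (syzygy M n.+1)).
    move=> ncob; apply: (noExt (syzygy M n.+1)).
    exists (free_resolution M), (free_cover (syzygy M n.+1)).
    by split=> // y; apply: kermodP.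
  have [g gE] := cob.
  have gK : cancel (syzygy_incl M n) g.
    by move=> z; have [y <-] := free_cover_surj z; exact/esym/gE.
  by rewrite subn0; split; apply: ann_exact_retract gK _; apply: ann_exact_free.
have [exs exs'] := IH (ltnW lt_i_n).
have E : (n.+1 - i = (n.+1 - i.+1).+1)%N by rewrite subnSK.
rewrite E in exs exs'.
by split; (apply: ann_exact_quotient (@free_cover_surj _ _) _ _;
  [done | exact: ann_exact_free | done]).
Qed.
End Periodic.

(** * The group algebra at an element of prime order *)

Section OrbitTransversal.
Variables (G : groupType) (p : nat) (s : G).
Hypotheses (p_pr : prime p) (s_neq1 : s <> 1%g) (s_p : (s ^+ p = 1)%g).

Lemma expg_prime_order_neq1 d : (0 < d < p)%N -> (s ^+ d)%g <> 1%g.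
Proof.
move=> /andP[d_gt0 lt_d_p] sd; apply: s_neq1.
have cop : coprime d p by rewrite coprime_sym prime_coprime // gtnNdvd.
case: (@egcdnP d p d_gt0) => u v uvE _; move: uvE; rewrite (eqP cop) addn1.
move=> /(congr1 (fun e => s ^+ e)%g).
by rewrite mulnC expgnA sd expg1n expgS mulnC expgnA s_p expg1n mulg1.
Qed.

Lemma expg_prime_order_inj k j :
  (k < p)%N -> (j < p)%N -> (s ^+ k = s ^+ j)%g -> k = j.
Proof.
wlog le_kj : k j / (k <= j)%N.
  move=> H kp jp E; case/orP: (leq_total k j) => [|]/H; first exact.
  by move=> H'; apply/esym/H'.
move=> kp jp E; apply/eqP; rewrite eqn_leq le_kj leqNgt; apply/negP => lt_kj.
apply: (@expg_prime_order_neq1 (j - k)).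
  by rewrite subn_gt0 lt_kj (leq_ltn_trans (leq_subr _ _) jp).
by apply: (@mulgI _ (s ^+ k)%g); rewrite -expgnDr subnKC // mulg1.
Qed.

Definition in_orbit (g : G) : pred G :=
  fun x => `[< exists k, x = (s ^+ k * g)%g >].

Definition orbit_repr (g : G) : G := choose (in_orbit g) g.

Lemma orbit_reprP g : exists2 k, (k < p)%N & orbit_repr g = (s ^+ k * g)%g.
Proof.
have /asboolP[k kE] : in_orbit g (orbit_repr g).
  by apply: chooseP; apply/asboolP; exists 0%N; rewrite mul1g.
exists (k %% p)%N; first by rewrite ltn_mod prime_gt0.
rewrite kE {1}(divn_eq k p) expgnDr mulnC expgnA s_p expg1n.
by rewrite mul1g.
Qed.

Lemma orbit_repr_expM j g : orbit_repr (s ^+ j * g)%g = orbit_repr g.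
Proof.
have E : in_orbit (s ^+ j * g)%g =1 in_orbit g.
  move=> x; apply: asbool_equiv_eq; split=> -[k ->].
    by exists (k + j)%N; rewrite expgnDr mulgA.
  exists (k + j * p.-1)%N; rewrite mulgA -expgnDr -addnA -mulnSr.
  by rewrite prednK ?prime_gt0 // expgnDr mulnC expgnA s_p expg1n mulg1.
rewrite /orbit_repr (eq_choose E); apply: choose_id; apply/asboolP.
  by exists j.
by exists 0%N; rewrite mul1g.
Qed.

(** The representatives meet every orbit of the left translation by [s] in
    exactly one element, and an orbit has exactly [p] elements. *)
Lemma orbit_repr_count (V : nmodType) (v : V) g :
  \sum_(k < p)
    (if orbit_repr (s ^+ k * g)%g == (s ^+ k * g)%g then v else 0) = v.
Proof.
have [j jp jE] := orbit_reprP g.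
rewrite (bigD1 (Ordinal jp)) //= orbit_repr_expM jE eqxx big1 ?addr0 // => k.
rewrite orbit_repr_expM jE => neq_kj; case: eqP => // /mulIg E.
have jk := expg_prime_order_inj jp (ltn_ord k) E.
by case/eqP: neq_kj; apply: val_inj.
Qed.
End OrbitTransversal.

Section GroupAlgebraGenerators.
Variables (K : fieldType) (G : groupType).
Local Notation KG := (grpalg K G).

Definition ga_gen (g : G) : KG := << 1 *g g >>.

Lemma ga_genM g h : ga_gen g * ga_gen h = ga_gen (g * h)%g.
Proof. by rewrite ga_mulE ga_mulUU mulr1. Qed.

Lemma ga_genX g k : ga_gen g ^+ k = ga_gen (g ^+ k)%g.
Proof.
elim: k => [|k IH]; first by [].
by rewrite exprS IH ga_genM expgS.
Qed.

End GroupAlgebraGenerators.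
Arguments ga_gen {K G}.

Section Torsion.
Variables (K : fieldType) (G : groupType) (p : nat) (t : G).
Hypotheses (p_pr : prime p) (t_neq1 : t <> 1%g) (t_p : (t ^+ p = 1)%g).
Local Notation KG := (grpalg K G).

Let T : KG := ga_gen t.
Let S : KG := ga_gen t^-1%g.

Let ST : S * T = 1. Proof. by rewrite ga_genM mulVg. Qed.
Let Tp : T ^+ p = 1. Proof. by rewrite ga_genX t_p. Qed.

Definition torsion_norm : KG := \sum_(k < p) T ^+ k.

Lemma torsion_subM_norm : (T - 1) * torsion_norm = 0.
Proof. by rewrite -subrX1 Tp subrr. Qed.

Lemma torsion_normM_sub : torsion_norm * (T - 1) = 0.
Proof.
rewrite -torsion_subM_norm; apply/commr_sym/commr_sum => k _.
by apply/commrX/commr_sym/commrB; [exact: commr_refl | exact: commr1].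
Qed.

Definition transversal_proj : {linear KG -> KG} :=
  @free_ext K G KG (fun g => if orbit_repr t^-1%g g == g then ga_gen g else 0).

(** Higman's criterion for the subgroup generated by [t]: as [K G] is free over
    the group algebra of that subgroup, the identity is the trace of a map,
    here of the [K]-linear projection onto a transversal. *)
Lemma transversal_proj_trace x :
  x = \sum_(k < p) T ^+ k * transversal_proj (S ^+ k * x).
Proof.
have tV_neq1 : (t^-1 <> 1)%g.
  by move=> /(congr1 (fun g => g^-1)%g); rewrite invgK invg1.
have tV_p : (t^-1 ^+ p = 1)%g by rewrite expVgn t_p invg1.
elim/ga_ind: x => [|x y xE yE|c g].
- by rewrite big1 // => k _; rewrite mulr0 raddf0 mulr0.
- rewrite {1}xE {1}yE -big_split; apply: eq_bigr => k _.
  by rewrite [in RHS]mulrDr linearD mulrDr.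
have -> : << c *g g >> = c *: ga_gen g by rewrite ga_scaleUE mulr1.
rewrite -{1}(orbit_repr_count p_pr tV_neq1 tV_p (ga_gen g) g) scaler_sumr.
apply: eq_bigr => k _.
rewrite -scalerAr linearZ -scalerAr !ga_genX ga_genM; congr (_ *: _).
rewrite /transversal_proj free_extU scale1r.
case: eqP => _; last by rewrite mulr0.
by rewrite ga_genM expVgn mulVKg.
Qed.

Lemma grpalg_exact_norm x :
  (T - 1) * x = 0 -> exists y, x = torsion_norm * y.
Proof.
move=> /eqP; rewrite mulrBl mul1r subr_eq0 => /eqP Tx.
have Sx k : S ^+ k * x = x.
  elim: k => [|k IH]; first by rewrite mul1r.
  by rewrite exprSr -mulrA -{1}Tx [S * _]mulrA ST mul1r IH.
exists (transversal_proj x); rewrite {1}(transversal_proj_trace x) mulr_suml.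
by apply: eq_bigr => k _; rewrite Sx.
Qed.

Lemma sum_expS : \sum_(k < p) S ^+ k = T * torsion_norm.
Proof.
rewrite mulr_sumr (reindex_inj rev_ord_inj); apply: eq_bigr => k _ /=.
rewrite -exprS !ga_genX; congr ga_gen.
by rewrite expVgn; apply: mulg1_eq; rewrite -expgnDr subnK.
Qed.

(** With [x] the trace of the projection [pi], subtracting
    [pi (torsion_norm * x) = 0] replaces each [T ^+ k] by [T ^+ k - 1], a
    multiple of [T - 1]. *)
Lemma grpalg_exact_sub x :
  torsion_norm * x = 0 -> exists y, x = (T - 1) * y.
Proof.
move=> Nx; exists (\sum_(k < p) (\sum_(i < k) T ^+ i) *
  transversal_proj (S ^+ k * x)).
have Sx : \sum_(k < p) transversal_proj (S ^+ k * x) = 0.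
  by rewrite -linear_sum -mulr_suml sum_expS -mulrA Nx mulr0 raddf0.
rewrite {1}(transversal_proj_trace x) mulr_sumr -[LHS]subr0 -[X in _ - X]Sx.
rewrite -sumrB.
by apply: eq_bigr => k _; rewrite mulrA -subrX1 mulrBl mul1r.
Qed.

Lemma trivmod_not_exact : p \in [pchar K] ->
  ~ ann_exact (T - 1) torsion_norm (trivmod K G).
Proof.
move=> pK ex; have [|y] := ex (1 : K).
  by rewrite scalerBl triv_scaleE scale1r subrr.
rewrite scaler_suml (eq_bigr (fun=> y)) => [|k _]; last first.
  by rewrite ga_genX triv_scaleE.
rewrite sumr_const card_ord.
have -> : y *+ p = (y : K) *+ p by [].
rewrite -mulr_natr (pcharf0 pK) mulr0 => /eqP.
by rewrite oner_eq0.
Qed.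

Lemma Ext_trivmod_torsion n : p \in [pchar K] ->
  exists V : lmodType KG, Ext_neq0 n.+1 (trivmod K G) V.
Proof.
move=> pK; apply: contrapT => noExt; apply: (trivmod_not_exact pK).
apply: ann_exact_Ext torsion_subM_norm torsion_normM_sub _ _ _.
- exact: grpalg_exact_norm.
- exact: grpalg_exact_sub.
- by move=> V VE; apply: noExt; exists V; exact: VE.
Qed.
End Torsion.

(** * The partial group algebra over the group algebra *)

Section ParToGroup.
Variables (K : fieldType) (G : groupType).
Local Notation KG := (grpalg K G).
Local Notation A := (paralg K G).

Fixpoint term_to_ga (u : par_term K G) : KG :=
  match u with
  | PGen g => ga_gen g
  | PCst c => c%:A
  | PAdd u v => term_to_ga u + term_to_ga v
  | PMul u v => term_to_ga u * term_to_ga v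
  end.

Lemma term_to_ga_cong u v : par_cong u v -> term_to_ga u = term_to_ga v.
Proof.
elim=> //= {u v}.
- by move=> s u v _ -> _ ->.
- by move=> s s' u u' _ -> _ ->.
- by move=> s s' u u' _ -> _ ->.
- by move=> s u v; rewrite addrA.
- by move=> s u; rewrite addrC.
- by move=> u; rewrite scale0r add0r.
- by move=> u; rewrite scaleN1r mulN1r addNr scale0r.
- by move=> s u v; rewrite mulrA.
- by move=> u; rewrite scale1r mul1r.
- by move=> u; rewrite scale1r mulr1.
- by move=> s u v; rewrite mulrDl.
- by move=> s u v; rewrite mulrDr.
- by move=> a b; rewrite scalerDl.
- by move=> a b; rewrite -scalerAl mul1r scalerA.
- by move=> a u; rewrite -scalerAl mul1r -scalerAr mulr1.
- by move=> g h; rewrite !ga_genM.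
- by move=> g h; rewrite !ga_genM mulgA.
- by rewrite scale1r.
Qed.

Definition par_to_ga (a : A) : KG := term_to_ga (par_repr a).

Lemma par_to_ga_pi u : par_to_ga (par_pi u) = term_to_ga u.
Proof. exact: term_to_ga_cong (par_repr_pi u). Qed.

Lemma par_to_ga1 : par_to_ga 1 = 1.
Proof. by rewrite -par_pi1 par_to_ga_pi /= scale1r. Qed.

Lemma par_to_gaD : {morph par_to_ga : a b / a + b}.
Proof.
elim/par_pi_ind=> u; elim/par_pi_ind=> v.
by rewrite -par_piD !par_to_ga_pi.
Qed.

Lemma par_to_gaM : {morph par_to_ga : a b / a * b}.
Proof.
elim/par_pi_ind=> u; elim/par_pi_ind=> v.
by rewrite -par_piM !par_to_ga_pi.
Qed.

Lemma par_to_ga_gen g : par_to_ga (par_gen K g) = ga_gen g.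
Proof. exact: par_to_ga_pi. Qed.

Lemma par_to_ga_cst c : par_to_ga c%:A = c%:A.
Proof. by rewrite -par_piC par_to_ga_pi. Qed.

Lemma par_to_gaZ c a : par_to_ga (c *: a) = c *: par_to_ga a.
Proof.
by rewrite -[a]mul1r scalerAl !par_to_gaM par_to_ga_cst par_to_ga1 -scalerAl.
Qed.

Lemma par_to_ga_idem g : par_to_ga (par_idem K g) = 1.
Proof. by rewrite par_to_gaM !par_to_ga_gen ga_genM mulgV. Qed.

(** A [K]-linear section of [par_to_ga]. It is multiplicative only up to
    elements killed by some product of the idempotents [par_idem]. *)
Definition ga_to_par : {linear KG -> A} := @free_ext K G A (@par_gen K G).

Lemma ga_to_par_gen g : ga_to_par (ga_gen g) = par_gen K g.
Proof. by rewrite /ga_to_par free_extU scale1r. Qed.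

Lemma ga_to_par1 : ga_to_par 1 = 1.
Proof. by rewrite (ga_to_par_gen 1%g) par_gen1. Qed.

Lemma ga_to_par_cst c : ga_to_par c%:A = c%:A.
Proof. by rewrite linearZ ga_to_par1. Qed.

Lemma ga_to_parK : cancel ga_to_par par_to_ga.
Proof.
elim/ga_ind=> [|a b aK bK|c g].
- by rewrite raddf0 -(scale0r 1) par_to_gaZ !scale0r.
- by rewrite raddfD par_to_gaD; congr (_ + _).
- by rewrite /ga_to_par free_extU par_to_gaZ par_to_ga_gen ga_scaleUE mulr1.
Qed.

Definition par_idems (F : seq G) : A := \prod_(g <- F) par_idem K g.

Lemma par_idems1 g : par_idems [:: g] = par_idem K g.
Proof. by rewrite /par_idems big_seq1. Qed.

Lemma par_idems_cat F F' : par_idems (F ++ F') = par_idems F * par_idems F'.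
Proof. by rewrite /par_idems big_cat. Qed.

Lemma par_idemsC F F' : par_idems F * par_idems F' = par_idems F' * par_idems F.
Proof.
apply: commr_prod => h _; apply/commr_sym; apply: commr_prod => g _.
exact: par_idemC.
Qed.

Lemma par_gen_idems g F :
  par_gen K g * par_idems F = par_idems [seq (g * h)%g | h <- F] * par_gen K g.
Proof.
elim: F => [|h F IH]; first by rewrite /par_idems !big_nil mul1r mulr1.
by rewrite /par_idems /= !big_cons mulrA par_gen_idem -mulrA IH mulrA.
Qed.

Lemma par_idem_genM g h :
  par_idem K g * (par_gen K g * par_gen K h) =
  par_idem K g * par_gen K (g * h)%g :> A.
Proof. by rewrite /par_idem -!mulrA [par_gen K g^-1%g * _]mulrA par_rell. Qed.

Lemma par_to_ga_idems F : par_to_ga (par_idems F) = 1.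
Proof.
elim: F => [|h F IH]; first by rewrite /par_idems big_nil par_to_ga1.
by rewrite /par_idems big_cons par_to_gaM par_to_ga_idem mul1r.
Qed.
End ParToGroup.
Arguments ga_to_par {K G}.

Section Restriction.
Variables (K : fieldType) (G : groupType) (V : lmodType (grpalg K G)).

Definition resmod : Type := V.
HB.instance Definition _ := GRing.Zmodule.copy resmod V.

Definition res_scale (a : paralg K G) (v : resmod) : resmod :=
  par_to_ga a *: (v : V).

Fact res_scaleA a b v : res_scale a (res_scale b v) = res_scale (a * b) v.
Proof. by rewrite /res_scale par_to_gaM scalerA. Qed.
Fact res_scale1 : left_id 1 res_scale.
Proof. by move=> v; rewrite /res_scale par_to_ga1 scale1r. Qed.
Fact res_scaleDr : right_distributive res_scale +%R.
Proof. by move=> a u v; rewrite /res_scale scalerDr. Qed.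
Fact res_scaleDl v : {morph res_scale^~ v : a b / a + b}.
Proof. by move=> a b; rewrite /res_scale par_to_gaD scalerDl. Qed.

HB.instance Definition _ := GRing.Zmodule_isLmodule.Build (paralg K G) resmod
  res_scaleA res_scale1 res_scaleDr res_scaleDl.

Lemma resmodE (a : paralg K G) (v : resmod) : a *: v = par_to_ga a *: (v : V).
Proof. by []. Qed.
End Restriction.

Section Killed.
Variables (K : fieldType) (G : groupType) (M : lmodType (paralg K G)).
Local Notation A := (paralg K G).
Local Notation KG := (grpalg K G).

(** The submodule generated by the elements [x - e_g x]: a finite sum of these
    is killed by the product of the [e_g] involved, and conversely an element
    [x] killed by such a product [e] is [x - e x]. *)
Definition killed : {pred M} :=
  fun x => `[< exists F, par_idems K F *: x = 0 >].

Lemma killedP x : reflect (exists F, par_idems K F *: x = 0) (x \in killed).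
Proof. exact: asboolP. Qed.

Lemma killedD x y : x \in killed -> y \in killed -> x + y \in killed.
Proof.
move=> /killedP[F Fx] /killedP[F' Fy]; apply/killedP; exists (F ++ F').
rewrite scalerDr par_idems_cat {1}par_idemsC -!scalerA.
by rewrite Fx Fy !scaler0 addr0.
Qed.

(** For [a = [g]] this is [[g] e_h = e_(gh) [g]]: the killing product is
    translated by [g]. *)
Lemma killedZ a x : x \in killed -> a *: x \in killed.
Proof.
elim/par_pi_ind: a => u; elim: u x => [g|c|u IHu v IHv|u IHu v IHv] x xk.
- have /killedP[F Fx] := xk; apply/killedP; exists [seq (g * h)%g | h <- F].
  by rewrite scalerA -par_gen_idems -scalerA Fx scaler0.
- have /killedP[F Fx] := xk; apply/killedP; exists F.
  by rewrite par_piC scalerA -scalerAr mulr1 -mulr_algl -scalerA Fx scaler0.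
- by rewrite par_piD scalerDl killedD ?IHu ?IHv.
- by rewrite par_piM -scalerA IHu ?IHv.
Qed.

Lemma killed_submod : submod_closed killed.
Proof.
split=> [|a x y xk yk]; last by rewrite killedD ?killedZ.
by apply/killedP; exists [::]; rewrite scaler0.
Qed.

HB.instance Definition _ := GRing.isSubmodClosed.Build A M killed killed_submod.

(** On basis elements the difference of the two sides is killed by [e_g], since
    [e_g [g][h] = e_g [gh]]; bilinearity gives the rest. *)
Lemma killed_mul (a b : KG) (x : M) :
  ga_to_par (a * b) *: x - (ga_to_par a * ga_to_par b) *: x \in killed.
Proof.
elim/ga_ind: a => [|a a' IH IH'|c g].
- by rewrite mul0r raddf0 mul0r subrr rpred0.
- rewrite mulrDl !raddfD mulrDl !scalerDl opprD addrACA.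
  exact: rpredD.
elim/ga_ind: b => [|b b' IH IH'|d h].
- by rewrite mulr0 raddf0 mulr0 subrr rpred0.
- rewrite mulrDr !raddfD mulrDr !scalerDl opprD addrACA.
  exact: rpredD.
rewrite ga_mulE ga_mulUU /ga_to_par !free_extU.
rewrite -scalerAl -scalerAr scalerA -scalerBl -scalerBr.
rewrite -mulr_algl -scalerA rpredZ //.
apply/killedP; exists [:: g].
by rewrite par_idems1 scalerA mulrBr par_idem_genM subrr scale0r.
Qed.
End Killed.

(** * Extension of scalars to the group algebra *)

Section Unitalization.
Variables (K : fieldType) (G : groupType) (M : lmodType (paralg K G)).
Local Notation KG := (grpalg K G).

(** The largest quotient of [M] on which every [e_g] acts as the identity. On
    it [[g][h]] and [[gh]] agree, so the group algebra acts; this is the tensor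
    product of the group algebra with [M] over the partial group algebra. *)
Definition unital : Type := Quotient.quot (killed (M := M)).
HB.instance Definition _ := GRing.Zmodule.on unital.

Definition unital_pi (x : M) : unital := \pi x.
Definition unital_repr (x : unital) : M :=
  repr (x : Quotient.quot (killed (M := M))).

Lemma unital_reprK : cancel unital_repr unital_pi.
Proof. exact: reprK. Qed.

Lemma unital_piD : {morph unital_pi : x y / x + y}.
Proof. by move=> x y; rewrite /unital_pi raddfD. Qed.

Lemma unital_piB : {morph unital_pi : x y / x - y}.
Proof. by move=> x y; rewrite /unital_pi raddfB. Qed.

Lemma unital_pi_eq x y :
  unital_pi x = unital_pi y <-> x - y \in killed (M := M).
Proof.
rewrite /unital_pi; split=> [/eqP|xy]; last apply/eqP;
  by rewrite -Quotient.idealrBE.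
Qed.

Lemma unital_pi_ind (Q : unital -> Prop) :
  (forall x, Q (unital_pi x)) -> forall x, Q x.
Proof. by move=> H x; rewrite -(unital_reprK x). Qed.

Definition unital_scale (a : KG) (x : unital) : unital :=
  unital_pi (ga_to_par a *: unital_repr x).

Lemma unital_scale_pi a x :
  unital_scale a (unital_pi x) = unital_pi (ga_to_par a *: x).
Proof.
apply/unital_pi_eq; rewrite -scalerBr; apply: killedZ.
by apply/unital_pi_eq; rewrite unital_reprK.
Qed.

Fact unital_scaleA a b x :
  unital_scale a (unital_scale b x) = unital_scale (a * b) x.
Proof.
elim/unital_pi_ind: x => x; rewrite !unital_scale_pi scalerA.
by apply/esym/unital_pi_eq/killed_mul.
Qed.
Fact unital_scale1 : left_id 1 unital_scale.
Proof.
by elim/unital_pi_ind=> x; rewrite unital_scale_pi ga_to_par1 scale1r.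
Qed.
Fact unital_scaleDr : right_distributive unital_scale +%R.
Proof.
move=> a; elim/unital_pi_ind=> x; elim/unital_pi_ind=> y.
by rewrite -unital_piD !unital_scale_pi scalerDr unital_piD.
Qed.
Fact unital_scaleDl x : {morph unital_scale^~ x : a b / a + b}.
Proof.
move=> a b; elim/unital_pi_ind: x => x.
by rewrite !unital_scale_pi raddfD scalerDl unital_piD.
Qed.

HB.instance Definition _ := GRing.Zmodule_isLmodule.Build KG unital
  unital_scaleA unital_scale1 unital_scaleDr unital_scaleDl.

Lemma unital_pi_par r x : unital_pi (r *: x) = par_to_ga r *: unital_pi x.
Proof.
have scE a y : a *: unital_pi y = unital_pi (ga_to_par a *: y).
  exact: unital_scale_pi.
elim/par_pi_ind: r => u; elim: u x => [g|c|u IHu v IHv|u IHu v IHv] x.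
- by rewrite scE par_to_ga_gen ga_to_par_gen.
- by rewrite par_piC par_to_ga_cst scE ga_to_par_cst.
- by rewrite par_piD scalerDl unital_piD IHu IHv par_to_gaD scalerDl.
- by rewrite par_piM -scalerA IHu IHv par_to_gaM scalerA.
Qed.

Lemma unital_pi_linear : linear (unital_pi : M -> resmod unital).
Proof. by move=> r x y; rewrite unital_piD unital_pi_par. Qed.

Definition to_unital : {linear M -> resmod unital} :=
  linear_pack unital_pi_linear.

Lemma unital_pi_eq0 x : unital_pi x = 0 <-> exists F, par_idems K F *: x = 0.
Proof.
have <- : unital_pi 0 = 0 by have := raddf0 to_unital.
by rewrite unital_pi_eq subr0; split=> /killedP.
Qed.

(** The adjunction between extension and restriction of scalars. A map into a
    restricted module vanishes on the elements killed by a product of the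
    [e_g], as these products act there as the identity. *)
Section Lift.
Variables (V : lmodType KG) (f : {linear M -> resmod V}).

Definition unital_lift_fun (x : unital) : V := f (unital_repr x).

Lemma unital_lift_fun_pi x : unital_lift_fun (unital_pi x) = f x.
Proof.
apply/eqP; rewrite -subr_eq0; apply/eqP.
have -> : unital_lift_fun (unital_pi x) - f x =
    f (unital_repr (unital_pi x) - x) by rewrite raddfB.
have /unital_pi_eq/killedP[F] := unital_reprK (unital_pi x).
move=> /(congr1 f); rewrite linearZ raddf0 /= resmodE par_to_ga_idems.
by rewrite scale1r.
Qed.

Lemma unital_lift_fun_linear : linear unital_lift_fun.
Proof.
move=> a; elim/unital_pi_ind=> x; elim/unital_pi_ind=> y.
rewrite -(ga_to_parK a) -unital_pi_par -unital_piD !unital_lift_fun_pi.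
by rewrite linearP.
Qed.

Definition unital_lift : {linear unital -> V} :=
  linear_pack unital_lift_fun_linear.

Lemma unital_lift_pi x : unital_lift (unital_pi x) = f x.
Proof. exact: unital_lift_fun_pi. Qed.
End Lift.
End Unitalization.

Section UnitalFunctor.
Variables (K : fieldType) (G : groupType).
Local Notation KG := (grpalg K G).
Local Notation A := (paralg K G).

Definition unital_map (M N : lmodType A) (f : {linear M -> N}) :
  {linear unital M -> unital N} := unital_lift (to_unital N \o f).

Lemma unital_map_pi (M N : lmodType A) (f : {linear M -> N}) x :
  unital_map f (unital_pi x) = unital_pi (f x).
Proof. exact: unital_lift_pi. Qed.

Lemma unital_pi_idems (M : lmodType A) F (x : M) :
  unital_pi (par_idems K F *: x) = unital_pi x.
Proof. by rewrite unital_pi_par par_to_ga_idems scale1r. Qed.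

(** Exactness of localisation: if [d] hits [x] after multiplication by a
    product of the [e_g], then the class of [d] hits that of [x], since [x] and
    its multiple have the same class. The form with a lifted [f] also covers
    the augmentation of [unital_resolution]. *)
Lemma unital_lift_eq0 (L M : lmodType A) (V : lmodType KG)
    (d : {linear L -> M}) (f : {linear M -> resmod V}) :
  (forall x, f x = 0 <-> exists F y, d y = par_idems K F *: x) ->
  forall x, unital_lift f x = 0 <-> exists y, unital_map d y = x.
Proof.
move=> fd; elim/unital_pi_ind=> x; rewrite unital_lift_pi fd; split.
  move=> [F [y yE]]; exists (unital_pi y).
  by rewrite unital_map_pi yE unital_pi_idems.
move=> [y]; elim/unital_pi_ind: y => y; rewrite unital_map_pi => dyE.
have : unital_pi (x - d y) = 0 by rewrite unital_piB dyE subrr.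
move=> /unital_pi_eq0[F FE]; exists F, (par_idems K F *: y).
by apply/eqP; rewrite linearZ eq_sym -subr_eq0 -scalerBr FE.
Qed.

Lemma unital_map_exact (L M N : lmodType A)
    (d : {linear L -> M}) (f : {linear M -> N}) :
  (forall x, f x = 0 <-> exists y, d y = x) ->
  forall x, unital_map f x = 0 <-> exists y, unital_map d y = x.
Proof.
move=> fd; apply: unital_lift_eq0 => x.
change (unital_pi (f x) = 0 <-> exists F y, d y = par_idems K F *: x).
rewrite unital_pi_eq0; split=> -[F].
  by rewrite -linearZ => /fd [y yE]; exists F, y.
by move=> yE; exists F; rewrite -linearZ; apply/fd.
Qed.

(** A lifting problem for [unital P] over the group algebra is, by adjunction,
    one for [P] over the partial group algebra. *)
Lemma unital_projective (P : lmodType A) :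
  projective P -> projective (unital P : lmodType KG).
Proof.
move=> projP M N p f p_surj.
have pL : linear (p : resmod M -> resmod N).
  by move=> a x y; exact: (linearP p (par_to_ga a) x y).
have fL : linear (fun x => f (unital_pi x) : resmod N).
  by move=> a x y; rewrite unital_piD unital_pi_par linearP.
have [g gE] := projP _ _ (linear_pack pL) (linear_pack fL) p_surj.
exists (unital_lift g); elim/unital_pi_ind=> x.
by rewrite unital_lift_pi; exact: gE.
Qed.
End UnitalFunctor.

(** * The module B and the trivial module *)

Section Augmentation.
Variables (K : fieldType) (G : groupType).
Local Notation KG := (grpalg K G).
Local Notation A := (paralg K G).
Local Notation B := (parB K G).

Definition par_aug (a : A) : K := ga_aug (par_to_ga a).

Lemma par_augD : {morph par_aug : a b / a + b}.
Proof. by move=> a b; rewrite /par_aug par_to_gaD ga_augD. Qed.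

Lemma par_augM : {morph par_aug : a b / a * b}.
Proof. by move=> a b; rewrite /par_aug par_to_gaM ga_augM. Qed.

Lemma par_aug_gen g : par_aug (par_gen K g) = 1.
Proof. by rewrite /par_aug par_to_ga_gen ga_augU. Qed.

Lemma par_aug1 : par_aug 1 = 1.
Proof. by rewrite /par_aug par_to_ga1 ga_aug1. Qed.

Lemma par_aug_cst c : par_aug c%:A = c.
Proof. by rewrite /par_aug par_to_ga_cst ga_scaleUE mulr1 ga_augU. Qed.

Lemma par_augZ c a : par_aug (c *: a) = c * par_aug a.
Proof. by rewrite -mulr_algl par_augM par_aug_cst. Qed.

Lemma par_aug_act u x :
  par_aug (par_term_act u x) = par_aug (par_pi u) * par_aug x.
Proof.
elim: u x => [g|c|u IHu v IHv|u IHu v IHv] x /=.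
- by rewrite !par_augM !par_aug_gen mulr1.
- by rewrite par_piC par_aug_cst par_augZ.
- by rewrite par_piD !par_augD mulrDl IHu IHv.
- by rewrite par_piM par_augM IHu IHv mulrA.
Qed.

Lemma parB_aug_linear :
  linear (fun b : B => par_aug (val b) : resmod (trivmod K G)).
Proof.
move=> a x y; rewrite raddfD par_augD; congr (_ + _).
elim/par_pi_ind: a => u.
by have := parB_scale_pi u x => /= ->; rewrite par_aug_act.
Qed.

Definition parB_aug : {linear B -> resmod (trivmod K G)} :=
  linear_pack parB_aug_linear.

Lemma parB_aug_surj c : exists b, parB_aug b = c.
Proof.
have Bc : ((c : K)%:A : A) \in @in_parB K G by rewrite rpredZ ?rpred1.
by exists (ParB Bc); exact: par_aug_cst.
Qed.

(** The action of [e_g] on [B] is [b |-> e_g b e_g], which is [e_g b] as [B] is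
    commutative. *)
Lemma parB_scale_idems F (b : B) :
  val (par_idems K F *: b) = par_idems K F * val b.
Proof.
elim: F => [|g F IH]; first by rewrite /par_idems big_nil scale1r mul1r.
have idemE (c : B) : val (par_idem K g *: c) = par_idem K g * val c.
  rewrite -scalerA !parB_scale_gen invgK !mulrA.
  rewrite -/(par_idem K g) -mulrA -/(par_idem K g) -mulrA.
  by rewrite in_parB_comm_idem ?(valP c) // mulrA par_idem_idem.
by rewrite /par_idems !big_cons -scalerA idemE -mulrA IH.
Qed.

(** In [B] the kernel of the augmentation is generated by the idempotents
    [1 - par_idem K g], so [x] and its augmentation become equal
    after multiplication by a large enough product of the [par_idem K g]. *)
Lemma in_parB_idems x : x \in @in_parB K G ->
  exists F, par_idems K F * x = par_aug x *: par_idems K F.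
Proof.
move: x; apply: in_parB_ind => [|c x y [F FE] [F' FE']|x y [F FE] [F' FE']|g].
- by exists [::]; rewrite par_aug1 scale1r mulr1.
- exists (F ++ F'); rewrite par_idems_cat par_augD par_augZ.
  have Ex : par_idems K F * par_idems K F' * x =
      par_aug x *: (par_idems K F * par_idems K F').
    by rewrite par_idemsC -mulrA FE -scalerAr.
  rewrite mulrDr -scalerAr Ex -mulrA FE' -scalerAr.
  by rewrite scalerA -scalerDl.
- exists (F ++ F'); rewrite par_idems_cat par_augM mulrA.
  rewrite [_ * _ * x](_ : _ = par_aug x *: (par_idems K F * par_idems K F')).
    by rewrite -scalerAl -mulrA FE' -scalerAr scalerA.
  by rewrite par_idemsC -mulrA FE -scalerAr.
- exists [:: g]; rewrite par_idems1 par_idem_idem /par_aug par_to_ga_idem.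
  by rewrite ga_aug1 scale1r.
Qed.

Lemma parB_aug_eq0 b : parB_aug b = 0 <-> exists F, par_idems K F *: b = 0.
Proof.
split=> [b0|[F /(congr1 parB_aug)]].
  have [F FE] := in_parB_idems (valP b); exists F; apply: val_inj.
  by rewrite parB_scale_idems FE (b0 : par_aug (val b) = 0) scale0r.
by rewrite linearZ raddf0 /= resmodE par_to_ga_idems scale1r.
Qed.
End Augmentation.

(** * Transfer of resolutions and dimensions *)

Section UnitalResolution.
Variables (K : fieldType) (G : groupType) (Q : proj_resolution (parB K G)).

Definition res_aug : {linear pr_mod Q 0 -> resmod (trivmod K G)} :=
  @parB_aug K G \o pr_aug Q.

Lemma res_aug_surj c : exists x, unital_lift res_aug x = c.
Proof.
have [b bE] := parB_aug_surj c; have [x xE] := pr_aug_surj Q b.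
by exists (unital_pi x); rewrite unital_lift_pi /= xE.
Qed.

Lemma res_aug_exact x :
  unital_lift res_aug x = 0 <-> exists y, unital_map (pr_d Q 0) y = x.
Proof.
apply: unital_lift_eq0 => {}x; rewrite /= parB_aug_eq0.
split=> -[F].
  by rewrite -linearZ => /pr_exact0[y yE]; exists F, y.
by move=> yE; exists F; rewrite -linearZ; apply/pr_exact0.
Qed.

Definition unital_resolution : proj_resolution (trivmod K G) :=
  @ProjResolution (grpalg K G) (trivmod K G) (fun i => unital (pr_mod Q i))
    (fun i => unital_map (pr_d Q i)) (unital_lift res_aug)
    (fun i => unital_projective (@pr_projective _ _ Q i))
    res_aug_surj res_aug_exact
    (fun i => @unital_map_exact _ _ _ _ _ (pr_d Q i.+1) (pr_d Q i)
      (@pr_exactS _ _ Q i)).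

(** Cocycles and coboundaries correspond under the adjunction. *)
Lemma ext_unital_resolution (V : lmodType (grpalg K G)) i
    (f : {linear unital (pr_mod Q i) -> V}) :
  @ext_cocycle _ _ V unital_resolution i f ->
  ~ @ext_coboundary _ _ V unital_resolution i f ->
  exists f' : {linear pr_mod Q i -> resmod V},
    ext_cocycle f' /\ ~ ext_coboundary f'.
Proof.
move=> f_coc f_ncob.
have fL : linear (fun x => f (unital_pi x) : resmod V).
  by move=> a x y; rewrite unital_piD unital_pi_par linearP.
exists (linear_pack fL); split=> [y|].
  by rewrite linear_packE -unital_map_pi; exact: f_coc.
apply: contra_not f_ncob; case: i f f_coc fL => [|i] f f_coc fL.
  by move=> f0; elim/unital_pi_ind=> x; exact: f0.
move=> [g gE]; exists (unital_lift g); elim/unital_pi_ind=> x.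
change (f (unital_pi x)
  = unital_lift g (unital_map (pr_d Q i) (unital_pi x))).
by rewrite unital_map_pi unital_lift_pi; exact: gE.
Qed.
End UnitalResolution.

Lemma Ext_neq0_par (K : fieldType) (G : groupType) i
    (V : lmodType (grpalg K G)) :
  Ext_neq0 i (trivmod K G) V -> Ext_neq0 i (parB K G) (resmod V).
Proof.
pose Q := free_resolution (parB K G : lmodType (paralg K G)).
move=> /(Ext_neq0_resolution (unital_resolution Q))[f [f_coc f_ncob]].
by exists Q; exact: ext_unital_resolution f_coc f_ncob.
Qed.

Lemma maxe_mono (S T : pred nat) :
  (forall n, S n -> T n) -> (Defs.maxe S <= Defs.maxe T)%E.
Proof.
move=> ST; rewrite /Defs.maxe.
case: (pselect (exists n, S n)) => [S0|noS]; last first.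
  (* An empty [S] is bounded, so that its maximum is [-oo]. *)
  case: (pselect (exists m, forall n, S n -> (n <= m)%N)) => [|[]].
    by rewrite leNye.
  by exists 0%N => n Sn; case: noS; exists n.
case: (pselect (exists n, T n)) => [T0|noT]; last first.
  by case: noT; have [n Sn] := S0; exists n; exact: ST.
case: (pselect (exists m, forall n, T n -> (n <= m)%N))
  => [Tub|noTub]; last exact: leey.
case: pselect => [Sub|[]]; last first.
  by have [m mP] := Tub; exists m => n /ST; exact: mP.
rewrite lee_fin lez_nat; case: ex_maxnP => m Sm _; case: ex_maxnP => n _; apply.
exact: ST.
Qed.

Lemma maxe_pinfty (S : pred nat) : (forall n, S n.+1) -> Defs.maxe S = +oo%E.
Proof.
move=> allS; rewrite /Defs.maxe; case: pselect => [S0|[]]; last by exists 1%N.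
case: pselect => [bS|//]; exfalso; have [m mP] := bS; have := mP m.+1 (allS m).
by rewrite ltnn.
Qed.

Theorem corollaryC (K : fieldType) (G : groupType) :
  (cd K G <= cd_par K G)%E /\
  (forall p : nat, p \in [pchar K] -> has_torsion p G ->
     cd_par K G = +oo%E /\ cd K G = +oo%E).
Proof.
have le_cd : (cd K G <= cd_par K G)%E.
  apply: maxe_mono => i /asboolP[V VE]; apply/asboolP.
  by exists (resmod V); exact: Ext_neq0_par.
split=> // p pK [t [t_neq1 t_p]].
have cd_oo : cd K G = +oo%E.
  apply: maxe_pinfty => n; apply/asboolP.
  exact: (Ext_trivmod_torsion (pcharf_prime pK) t_neq1 t_p).
split=> //; apply/eqP; rewrite -leye_eq -cd_oo; exact: le_cd.
Qed.
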